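(* Let $X \subset \mathbb R^n$ be a regular convex set, and $f$ a projectively self-concordant barrier on $X$ with parameter $\gamma = \frac{\nu-2}{\sqrt{\nu-1}}$, $\nu\ge 2$. Let $G = f'' - f'f'^T$. Then for all $x \in X^o$ and $h \in \mathbb R^n$ we have \[ \max\left(0,f'(x)[h] + \frac{\sqrt{G(x)[h,h]}}{\sqrt{\nu-1}}\right) \leq \sigma_x(h) \leq \max\left(0,f'(x)[h] + \sqrt{\nu-1}\sqrt{G(x)[h,h]}\right), \] \[ |f'(x)[h]| + \frac{\sqrt{G(x)[h,h]}}{\sqrt{\nu-1}} \leq \pi_x(h) \leq |f'(x)[h]| + \sqrt{\nu-1}\sqrt{G(x)[h,h]}. \]
   Context: A regular convex set $X \subset \mathbb R^n$ is a closed convex set with non-empty interior $X^o$ containing no lines; $\partial X$ is its boundary. A projectively self-concordant barrier on $X$ with parameter $\gamma \geq 0$ is a $C^3$ function $f: X^o \to \mathbb R$ such that: (1) $f''(x) - f'(x)f'(x)^T \succ 0$ (positive definite) for all $x \in X^o$; (2) $\lim_{x \to\partial X} f(x) = +\infty$, i.e. $f(x_k)\to+\infty$ whenever $x_k \in X^o$ converges to a point of $\partial X$; (3) $|f'''(x)[h,h,h] - 6f''(x)[h,h]f'(x)[h] + 4(f'(x)[h])^3| \leq 2\gamma(f''(x)[h,h] - (f'(x)[h])^2)^{3/2}$ for all $x \in X^o$, $h \in \mathbb R^n$. For $x \in X^o$ and $h \in \mathbb R^n$ define $\sigma_x(h) = \inf\{ t^{-1} \mid t > 0,\ x + th \in X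 \}$ and $\pi_x(h) = \max(\sigma_x(h),\sigma_x(-h))$. *)

(* Defs.v *)
From mathcomp Require Import all_boot all_order all_algebra.
From mathcomp Require Import all_classical all_reals all_analysis.

Set Implicit Arguments.
Unset Strict Implicit.
Unset Printing Implicit Defensive.

Import Order.TTheory GRing.Theory Num.Theory.
Import numFieldNormedType.Exports.

Local Open Scope classical_set_scope.
Local Open Scope ring_scope.

Record regular_convex (R : realType) (n : nat) (X : set 'cV[R]_n) : Prop := {
  regular_convex_closed : closed X;
  regular_convex_convex : convex_set (X : set (convex_lmodType 'cV[R]_n));
  regular_convex_interior : interior X !=set0;
  regular_convex_no_line :
    ~ exists x h : 'cV[R]_n, h != 0 /\ forall t : R, X (x + t *: h) }.

Definition boundary (T : topologicalType) (A : set T) : set T :=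
  closure A `\` interior A.

(* Functions on an open set U are represented by total functions; their values
   outside U are irrelevant. Instead of iterating the (operator-valued)
   derivative, each step applies it to an arbitrary fixed vector h; in finite
   dimension this is the usual notion of C^k. *)
Fixpoint Ck_on (R : realType) (n : nat) (k : nat) (U : set 'cV[R]_n)
    (f : 'cV[R]_n -> R) : Prop :=
  if k is k'.+1 then
    (forall x, U x -> differentiable f x) /\
    (forall h : 'cV[R]_n, Ck_on k' U (fun x => 'd f x h))
  else forall x, U x -> {for x, continuous f}.

Section Derivatives.
Context {R : realType} {n : nat}.
Implicit Types (f : 'cV[R]_n -> R) (x u v w : 'cV[R]_n).

(* f'(x)[u], f''(x)[u, v] and f'''(x)[u, v, w] *)
Definition der1 f x u : R := 'd f x u.
Definition der2 f x u v : R := 'd (fun y => der1 f y u) x v.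
Definition der3 f x u v w : R := 'd (fun y => der2 f y u v) x w.

(* The bilinear form of the matrix f'' - f' f'^T *)
Definition metricG f x u v : R := der2 f x u v - der1 f x u * der1 f x v.

End Derivatives.

Record proj_sc_barrier (R : realType) (n : nat) (X : set 'cV[R]_n)
    (gamma : R) (f : 'cV[R]_n -> R) : Prop := {
  psc_param_ge0 : 0 <= gamma;
  psc_C3 : Ck_on 3 (interior X) f;
  (* the symmetry of metricG f x follows from psc_C3 *)
  psc_posdef : forall x : 'cV[R]_n, interior X x ->
    forall h : 'cV[R]_n, h != 0 -> 0 < metricG f x h h;
  psc_barrier : forall (u : nat -> 'cV[R]_n) (y : 'cV[R]_n),
    (forall k, interior X (u k)) -> boundary X y ->
    u @ \oo --> y -> f (u k) @[k --> \oo] --> +oo;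
  psc_third : forall x h : 'cV[R]_n, interior X x ->
    `|der3 f x h h h - 6 * der2 f x h h * der1 f x h + 4 * der1 f x h ^+ 3|
      <= 2 * gamma * (der2 f x h h - der1 f x h ^+ 2) `^ (3 / 2) }.

Section Gauge.
Context {R : realType} {n : nat}.
Implicit Types (X : set 'cV[R]_n) (x h : 'cV[R]_n).

Definition sigma X x h : R :=
  inf [set t^-1 | t in [set t : R | 0 < t /\ X (x + t *: h)]].

Definition pi_gauge X x h : R := Num.max (sigma X x h) (sigma X x (- h)).

End Gauge.

(* Main.v *)
(** Along a line [x + t h] put [p = f'[h]] and [s = sqrt (G[h, h])].  Then
    [p' = p^2 + s^2], and the third-order condition becomes
    [|s' - 2 p s| <= gamma s^2].  With [a = sqrt (nu - 1)] one has
    [gamma = a - 1/a], which is exactly what makes [v = p + s/a] satisfy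
    [v' >= v^2] and [w = p + a s] satisfy [w' <= w^2].  A solution of the first
    inequality blows up no later than at time [1 / v 0], so the line has left
    the interior by then.  By the second, [w], hence [p], stays bounded as long
    as [t] is bounded away from [1 / w 0] (for all time if [w 0 <= 0]); so [f]
    stays bounded along the line, and by the barrier property the line cannot
    reach the boundary earlier. *)
Require Import Defs.
From mathcomp Require Import all_boot all_order all_algebra.
From mathcomp Require Import all_classical all_reals all_analysis.
From mathcomp Require Import ring lra.
Import Order.TTheory GRing.Theory Num.Theory.
Import numFieldNormedType.Exports.
Local Open Scope classical_set_scope.
Local Open Scope ring_scope.

(** * Comparison for Riccati differential inequalities on an interval *)

Section Riccati.
Context {R : realType}.
Implicit Types (F w : R -> R) (a b c k t : R).

Lemma is_derive1_continuous F t (l : R) :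
  is_derive t 1 F l -> {for t, continuous F}.
Proof.
by case=> dF _; apply/differentiable_continuous/derivable1_diffP.
Qed.

Lemma is_derive1_within_continuous F (dF : R -> R) a b :
  (forall t, a <= t <= b -> is_derive t 1 F (dF t)) ->
  {within `[a, b], continuous F}.
Proof.
move=> FdF; apply: derivable_within_continuous => t; rewrite in_itv /= => tab.
by have [] := FdF t tab.
Qed.

Lemma le_increment F (dF : R -> R) a b k : a <= b ->
  (forall t, a <= t <= b -> is_derive t 1 F (dF t)) ->
  (forall t, a <= t <= b -> dF t <= k) -> F b - F a <= k * (b - a).
Proof.
move=> ab FdF dFk; have [||c] := @MVT_segment R F dF a b ab.
- by move=> t; rewrite in_itv /= => /andP[at_ tb]; apply: FdF; rewrite !ltW.
- exact: is_derive1_within_continuous FdF.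
- by rewrite in_itv /= => cab ->; rewrite ler_wpM2r ?subr_ge0 ?dFk.
Qed.

Lemma ge_increment F (dF : R -> R) a b k : a <= b ->
  (forall t, a <= t <= b -> is_derive t 1 F (dF t)) ->
  (forall t, a <= t <= b -> k <= dF t) -> k * (b - a) <= F b - F a.
Proof.
move=> ab FdF dFk; have [||c] := @MVT_segment R F dF a b ab.
- by move=> t; rewrite in_itv /= => /andP[at_ tb]; apply: FdF; rewrite !ltW.
- exact: is_derive1_within_continuous FdF.
- by rewrite in_itv /= => cab ->; rewrite ler_wpM2r ?subr_ge0 ?dFk.
Qed.

(* IVT makes the level set [w = c] nonempty; [t0] is its supremum. *)
Lemma last_crossing w a b c : a <= b ->
  (forall t, a <= t <= b -> {for t, continuous w}) -> w a <= c <= w b ->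
  exists2 t0, a <= t0 <= b &
    w t0 = c /\ forall t, t0 <= t <= b -> c <= w t.
Proof.
move=> ab cw /andP[wac cwb].
have cross s : a <= s -> s <= b -> w s <= c ->
    exists2 t, s <= t <= b & w t = c.
  move=> as_ sb wsc.
  have [||t] := @IVT R w s b c sb.
  - apply: continuous_in_subspaceT => t; rewrite inE /= in_itv /= => /andP[st tb].
    by apply: cw; rewrite (le_trans as_ st).
  - by rewrite ge_min wsc le_max cwb orbT.
  - by rewrite in_itv /= => tsb wtc; exists t.
pose A := [set t | a <= t <= b /\ w t = c].
have [t1 t1ab wt1] := cross a (lexx a) ab wac.
have supA : has_sup A.
  split; first by exists t1.
  by exists b => t [/andP[]].
have t1A : t1 <= sup A by apply: sup_upper_bound.
have A0 : A !=set0 by exists t1.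
have supAb : sup A <= b by apply: ge_sup => // t [/andP[]].
have asupA : a <= sup A by rewrite (le_trans _ t1A)//; case/andP: t1ab.
have supAab : a <= sup A <= b by rewrite asupA.
exists (sup A) => //; split.
  apply/eqP/negP => /negP wneq.
  have : \forall t \near sup A, w t != c.
    have /(cw _ supAab) // : nbhs (w (sup A)) [set y | y != c].
    by apply: open_nbhs_nbhs; split => //; exact: open_neq.
  case/nbhs_ballP => e /= e0 eball.
  have [t At lt] := sup_adherent e0 supA.
  have tle : t <= sup A by apply: sup_upper_bound.
  have : w t != c.
    apply: eball; rewrite /ball /= ger0_norm ?subr_ge0 //; lra.
  by case: At => _ ->; rewrite eqxx.
(* A value below [c] at [t] would force a crossing in [[t, b]]; being at most [sup A <= t], it would
   be [t] itself. *)
move=> t /andP[supt tb]; rewrite leNgt; apply/negP => wtc.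
have [s /andP[ts sb] wsc] := cross t (le_trans asupA supt) tb (ltW wtc).
have sA : s <= sup A by apply: sup_upper_bound => //; split => //; lra.
have st : s = t by lra.
by move: wtc; rewrite -st wsc ltxx.
Qed.

(** If [w 0 > 0], then [w] is nondecreasing, hence stays positive, and [1 / w] has slope at most -1.
    So [0 < 1 / w b <= 1 / w 0 - b]. *)
Lemma riccati_lt w (dw : R -> R) b : 0 <= b ->
  (forall t, 0 <= t <= b -> is_derive t 1 w (dw t)) ->
  (forall t, 0 <= t <= b -> w t ^+ 2 <= dw t) ->
  b * w 0 < 1.
Proof.
move=> b0 wdw dwge; have [w00|w00] := leP (w 0) 0.
  by rewrite (le_lt_trans _ ltr01) // mulr_ge0_le0.
have w_ge t : 0 <= t <= b -> w 0 <= w t.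
  move=> /andP[t0 tb]; rewrite -subr_ge0.
  have := @ge_increment w dw 0 t 0 t0.
  rewrite mul0r; apply => s /andP[s0 st]; first by apply: wdw; lra.
  by rewrite (le_trans (sqr_ge0 (w s)))// dwge; lra.
have w_gt t : 0 <= t <= b -> 0 < w t.
  by move=> tb; rewrite (lt_le_trans w00)// w_ge.
have := @le_increment (fun t => (w t)^-1) (fun t => - (w t) ^- 2 *: dw t) 0 b (-1) b0.
have -> : -1 * (b - 0) = - b by ring.
move=> H; have : (w b)^-1 - (w 0)^-1 <= - b.
  apply: H => t tb; first by apply: is_deriveV; rewrite ?gt_eqF ?w_gt //; exact: wdw.
  rewrite /GRing.scale /= mulNr lerN2 ler_pdivlMl ?mulr1 ?dwge //.
  by rewrite exprn_gt0 // w_gt.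
have wb : 0 < (w b)^-1 by rewrite invr_gt0 w_gt // b0 lexx.
move=> H1; rewrite -ltr_pdivlMr // mul1r; lra.
Qed.

(** Here [1 / w] has slope at least -1, but only where [w] is nonzero. If [w b > c], the comparison
    therefore starts at the last time [t0] with [w t0 = c], after which [w >= c > 0]. A bound
    [c > 0] in place of [w 0] allows [w 0 <= 0]. *)
Lemma riccati_le w (dw : R -> R) b c : 0 <= b -> 0 < c -> w 0 <= c -> b * c < 1 ->
  (forall t, 0 <= t <= b -> is_derive t 1 w (dw t)) ->
  (forall t, 0 <= t <= b -> dw t <= w t ^+ 2) ->
  w b <= (c^-1 - b)^-1.
Proof.
move=> b0 c0 w0c bc1 wdw dwle.
have cb : 0 < c^-1 - b by rewrite subr_gt0 -[c^-1]mul1r ltr_pdivlMr.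
have [wbc|cwb] := leP (w b) c.
  rewrite (le_trans wbc)// -[leLHS]invrK lef_pV2 ?posrE ?invr_gt0 //; lra.
have [||t0 /andP[t00 t0b] [wt0 ct]] := @last_crossing w 0 b c b0.
- by move=> t tb; apply: is_derive1_continuous (wdw t tb).
- by rewrite w0c ltW.
have w_gt t : t0 <= t <= b -> 0 < w t by move=> ?; rewrite (lt_le_trans c0) ?ct.
have := @ge_increment (fun t => (w t)^-1) (fun t => - (w t) ^- 2 *: dw t) t0 b (-1) t0b.
move=> H; have : -1 * (b - t0) <= (w b)^-1 - (w t0)^-1.
  apply: H => t tb.
    apply: is_deriveV; first by rewrite gt_eqF ?w_gt.
    by apply: wdw; lra.
  rewrite /GRing.scale /= mulNr lerN2 ler_pdivrMl ?mulr1; first by apply: dwle; lra.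
  by rewrite exprn_gt0 // w_gt.
rewrite wt0 => H1.
have wb0 : 0 < w b by rewrite w_gt // t0b lexx.
rewrite -[leLHS]invrK lef_pV2 ?posrE ?invr_gt0 //; lra.
Qed.

End Riccati.

(** * Differentiation along a line, and convex sets met by a line *)

Section Line.
Context {R : realType} {n : nat}.
Implicit Types (X : set 'cV[R]_n) (f : 'cV[R]_n -> R) (x y h : 'cV[R]_n).

Lemma is_diff_line x h (t : R) :
  is_diff t (fun s : R => x + s *: h) ( *:%R ^~ h).
Proof.
have -> : (fun s : R => x + s *: h) = cst x + *:%R ^~ h by apply/funext.
apply: (is_diff_eq (is_diffD (is_diff_cst x t) (is_diff_scalel t h))).
by apply/funext => s; rewrite fctE add0r.
Qed.

Lemma is_derive_line f x h (t : R) : differentiable f (x + t *: h) ->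
  is_derive t 1 (fun s : R => f (x + s *: h)) ('d f (x + t *: h) h).
Proof.
move=> df; have dl := is_diff_line x h t.
have dc : is_diff t (f \o (fun s : R => x + s *: h))
    ('d f (x + t *: h) \o *:%R ^~ h).
  by apply: is_diff_comp; exact: DiffDef.
have [dcomp dE] := dc.
apply: DeriveDef; first exact: diff_derivable.
by rewrite deriveE // -[LHS]/('d (f \o (fun s : R => x + s *: h)) t 1) dE /= scale1r.
Qed.

Lemma continuous_line x h : continuous (fun t : R => x + t *: h).
Proof. by move=> t; apply: differentiable_continuous; case: (is_diff_line x h t). Qed.

(** The homothety [g] with centre [y] and ratio [1 / (1 - t)] sends the given point to [x], so the
    preimage of [X] under [g] is a neighbourhood of that point. It lies in [X] by convexity, as
    [z = t y + (1 - t) g z]. *)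
Lemma interior_segment X x y (t : R) :
  convex_set (X : set (convex_lmodType 'cV[R]_n)) ->
  interior X x -> X y -> 0 <= t < 1 -> interior X (x + t *: (y - x)).
Proof.
move=> cX Xx Xy /andP[t0 t1].
have t1' : 0 < 1 - t by rewrite subr_gt0.
pose g := fun z : 'cV[R]_n => (1 - t)^-1 *: (z - t *: y).
have gx : g (x + t *: (y - x)) = x.
  rewrite /g (_ : _ - _ = (1 - t) *: x); first by rewrite scalerA mulVf ?scale1r ?gt_eqF.
  by apply/matrixP => i j; rewrite !mxE; ring.
have cg : {for x + t *: (y - x), continuous g}.
  apply: (@continuousZl_tmp _ _ _ (id - cst (t *: y))).
  by apply: continuousB; [move=> ? //|exact: cst_continuous].
have /cg Xg : nbhs (g (x + t *: (y - x))) X by rewrite gx.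
suff gX : g @^-1` X `<=` X.
  exact: (@filterS _ (nbhs (x + t *: (y - x))) _ _ _ gX Xg).
move=> z Xgz.
pose l : {i01 R} := Itv01 t0 (ltW t1).
have := cX y (g z) l; rewrite !inE => /(_ Xy Xgz).
suff -> : conv l (y : convex_lmodType _) (g z) = z by [].
rewrite -[LHS]/(t *: y + (1 - t) *: g z) /g scalerA mulfV ?gt_eqF // scale1r.
by rewrite addrC subrK.
Qed.

Lemma interior_line X x h (t r : R) :
  convex_set (X : set (convex_lmodType 'cV[R]_n)) ->
  interior X x -> X (x + t *: h) -> 0 <= r < t -> interior X (x + r *: h).
Proof.
move=> cX Xx Xt /andP[r0 rt]; have t0 : 0 < t by rewrite (le_lt_trans r0).
have := @interior_segment X x (x + t *: h) (r / t) cX Xx Xt.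
rewrite [x + t *: h - x]addrAC subrr add0r scalerA divfK ?gt_eqF //; apply.
by rewrite divr_ge0 ?(ltW t0) //= ltr_pdivrMr // mul1r.
Qed.

Lemma interior_line_near X x h (t : R) : interior X (x + t *: h) ->
  exists2 e, 0 < e & forall s, `|s - t| < e -> X (x + s *: h).
Proof.
move=> /(continuous_line x h t) /nbhs_ballP[e /= e0 eball].
by exists e => // s st; apply: eball; rewrite /ball /= distrC.
Qed.

End Line.

(** * The gauge as inverse exit time of a ray *)

Section Gauge.
Context {R : realType} {n : nat}.
Variables (X : set 'cV[R]_n) (x h : 'cV[R]_n).
Hypothesis Xx : interior X x.

Let S := [set t^-1 | t in [set t : R | 0 < t /\ X (x + t *: h)]].

Lemma sigma_lbound : lbound S 0.
Proof. by move=> _ [t [t0 _] <-]; rewrite invr_ge0 ltW. Qed.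

Lemma sigma_nonempty : S !=set0.
Proof.
have [|e e0 eX] := @interior_line_near _ _ X x h 0; first by rewrite scale0r addr0.
exists (e / 2)^-1; exists (e / 2) => //; split; first by rewrite divr_gt0.
by apply: eX; rewrite subr0 gtr0_norm ?divr_gt0 //; lra.
Qed.

Lemma sigma_le (t : R) : 0 < t -> X (x + t *: h) -> sigma X x h <= t^-1.
Proof. by move=> t0 Xt; apply: ge_inf; [exists 0; exact: sigma_lbound|exists t]. Qed.

Lemma sigma_ge (c : R) :
  (forall t, 0 < t -> X (x + t *: h) -> c <= t^-1) -> c <= sigma X x h.
Proof.
move=> ct; apply: lb_le_inf; first exact: sigma_nonempty.
by move=> _ [t [t0 Xt] <-]; exact: ct.
Qed.

Lemma sigma_ge0 : 0 <= sigma X x h.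
Proof. by apply: sigma_ge => t t0 _; rewrite invr_ge0 ltW. Qed.

Hypothesis convX : convex_set (X : set (convex_lmodType 'cV[R]_n)).

(** The product form of [t < 1 / sigma] also covers [sigma = 0], where the ray never leaves the
    interior. *)
Lemma interior_below_exit (t : R) : 0 <= t -> t * sigma X x h < 1 ->
  interior X (x + t *: h).
Proof.
rewrite le_eqVlt => /predU1P[<- _|t0 tS]; first by rewrite scale0r addr0.
have [|_ [r [r0 Xr] <-] rt] := @inf_lt R S t^-1 sigma_nonempty.
  by rewrite -[ltRHS]mul1r ltr_pdivlMr // mulrC.
apply: (@interior_line _ _ X x h r t convX Xx Xr); rewrite ltW //=.
by move: rt; rewrite ltf_pV2.
Qed.

Lemma boundary_exit : closed X -> 0 < sigma X x h ->
  boundary X (x + (sigma X x h)^-1 *: h).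
Proof.
move=> cX s0; set T := (sigma X x h)^-1.
have T0 : 0 < T by rewrite invr_gt0.
split.
  move=> B /(continuous_line x h T) /nbhs_ballP[e /= e0 eball].
  (* The bound [e / 2] keeps the earlier point [T - d] in the ball, and [T / 2] keeps its time
     positive. *)
  pose d := Num.min (e / 2) (T / 2).
  have d0 : 0 < d by rewrite lt_min !divr_gt0.
  have de : d <= e / 2 by rewrite ge_min lexx.
  have dT : d <= T / 2 by rewrite ge_min lexx orbT.
  exists (x + (T - d) *: h); split.
    apply: interior_subset; apply: interior_below_exit; first lra.
    by rewrite -ltr_pdivlMr // mul1r -/T; lra.
  by apply: eball; rewrite /ball /= opprB addrC subrK gtr0_norm //; lra.
(* Were the exit point interior, the ray would still be in [X] at time [T + e / 2], against
   [sigma_le]. *)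
move=> /interior_line_near [e e0 eX].
have Te0 : 0 < T + e / 2 by lra.
have := @sigma_le (T + e / 2) Te0.
rewrite -[sigma X x h]invrK -/T lef_pV2 ?posrE //.
have -> : (T + e / 2 <= T) = false by apply/negbTE; rewrite -ltNge; lra.
move=> H; suff // : false by [].
by apply: H; apply: eX; rewrite addrC addKr gtr0_norm; lra.
Qed.

End Gauge.

(** * Pointwise algebra behind the Riccati inequalities *)

Lemma third_order_riccati {R : realType} (gamma c p s : R) : 0 < s ->
  `|c - 6 * (p ^+ 2 + s ^+ 2) * p + 4 * p ^+ 3|
    <= 2 * gamma * (p ^+ 2 + s ^+ 2 - p ^+ 2) `^ (3 / 2) ->
  `|(2 * s)^-1 * (c - 2 * p * (p ^+ 2 + s ^+ 2)) - 2 * p * s|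
    <= gamma * s ^+ 2.
Proof.
move=> s0; set d := _ - 2 * p * s.
(* With [c] for f''' and [p ^+ 2 + s ^+ 2] for f'', [d] is s' - 2 p s; both sides of the hypothesis
   carry the factor [2 * s]. *)
have -> : c - 6 * (p ^+ 2 + s ^+ 2) * p + 4 * p ^+ 3 = 2 * s * d.
  by rewrite /d; field; rewrite gt_eqF.
have -> : (p ^+ 2 + s ^+ 2 - p ^+ 2) `^ (3 / 2) = s ^+ 3.
  rewrite addrAC subrr add0r mulrC powRrM powR12_sqrt ?sqr_ge0 //.
  by rewrite sqrtr_sqr gtr0_norm // powR_mulrn // ltW.
have s20 : 0 < 2 * s by rewrite mulr_gt0.
have -> : 2 * gamma * s ^+ 3 = 2 * s * (gamma * s ^+ 2) by ring.
by rewrite normrM gtr0_norm // ler_pM2l.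
Qed.

(** The difference of the two sides is exactly [a^-1] times the slack in the lower half of the
    third-order bound; [riccati_comb_le] uses the upper half with factor [a]. *)
Lemma riccati_comb_ge {R : realFieldType} (a p s ds : R) : 0 < a ->
  - ((a - a^-1) * s ^+ 2) <= ds - 2 * p * s ->
  (p + a^-1 * s) ^+ 2 <= p ^+ 2 + s ^+ 2 + a^-1 * ds.
Proof.
move=> a0 dsge; rewrite -subr_ge0 (_ : _ - _ =
  a^-1 * (ds - 2 * p * s - - ((a - a^-1) * s ^+ 2))).
  by rewrite mulr_ge0 ?invr_ge0 ?subr_ge0 // ltW.
by field; rewrite gt_eqF.
Qed.

Lemma riccati_comb_le {R : realFieldType} (a p s ds : R) : 0 < a ->
  ds - 2 * p * s <= (a - a^-1) * s ^+ 2 ->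
  p ^+ 2 + s ^+ 2 + a * ds <= (p + a * s) ^+ 2.
Proof.
move=> a0 dsle; rewrite -subr_ge0 (_ : _ - _ =
  a * ((a - a^-1) * s ^+ 2 - (ds - 2 * p * s))).
  by rewrite mulr_ge0 ?subr_ge0 // ltW.
by field; rewrite gt_eqF.
Qed.

(** * The barrier and its derivatives along a line *)

Section Barrier.
Context {R : realType} {n : nat}.
Variables (X : set 'cV[R]_n) (f : 'cV[R]_n -> R) (gamma : R).
Hypothesis hf : proj_sc_barrier X gamma f.
Variables (x h : 'cV[R]_n).

Let p t := der1 f (x + t *: h) h.
Let s t := Num.sqrt (metricG f (x + t *: h) h h).
Let ds t := (2 * s t)^-1 *
  (der3 f (x + t *: h) h h h - 2 * p t * der2 f (x + t *: h) h h).

Lemma is_derive_barrier t : interior X (x + t *: h) ->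
  is_derive t 1 (fun r => f (x + r *: h)) (p t).
Proof. by move=> Xt; apply: is_derive_line; apply: (psc_C3 hf).1. Qed.

Lemma is_derive_der1 t : interior X (x + t *: h) ->
  is_derive t 1 p (der2 f (x + t *: h) h h).
Proof.
move=> Xt; apply: (@is_derive_line _ _ (fun y => der1 f y h)).
exact: ((psc_C3 hf).2 h).1.
Qed.

Lemma is_derive_der2 t : interior X (x + t *: h) ->
  is_derive t 1 (fun r => der2 f (x + r *: h) h h) (der3 f (x + t *: h) h h h).
Proof.
move=> Xt; apply: (@is_derive_line _ _ (fun y => der2 f y h h)).
exact: (((psc_C3 hf).2 h).2 h).1.
Qed.

Hypothesis h0 : h != 0.

Lemma sqrt_metricG_gt0 t : interior X (x + t *: h) -> 0 < s t.
Proof. by move=> Xt; rewrite sqrtr_gt0 (psc_posdef hf). Qed.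

Lemma der2E t : interior X (x + t *: h) ->
  der2 f (x + t *: h) h h = p t ^+ 2 + s t ^+ 2.
Proof.
move=> Xt; rewrite sqr_sqrtr; last by rewrite ltW // (psc_posdef hf).
by rewrite /metricG -/(p t) expr2 [RHS]addrC subrK.
Qed.

(** Positive definiteness keeps the radicand positive, where the square root is differentiable. *)
Lemma is_derive_sqrt_metricG t : interior X (x + t *: h) ->
  is_derive t 1 s (ds t).
Proof.
move=> Xt; have g0 := psc_posdef hf Xt h0.
have dp := is_derive_der1 _ Xt.
have dq := is_derive_der2 _ Xt.
have dg := is_deriveB dq (is_deriveM dp dp).
have ds' := @is_derive1_comp _ Num.sqrt (fun r => metricG f (x + r *: h) h h) t _ _
  (is_derive1_sqrt g0) dg.
apply: (is_derive_eq ds').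
by rewrite /ds /GRing.scale /= -mulrA [2 * (_ * _)]mulr_natl mulr2n.
Qed.

Lemma sqrt_metricG_riccati t : interior X (x + t *: h) ->
  `|ds t - 2 * p t * s t| <= gamma * s t ^+ 2.
Proof.
move=> Xt; have s0 := sqrt_metricG_gt0 _ Xt.
have := psc_third hf h Xt.
rewrite /ds (der2E _ Xt) -/(p t).
move: (der3 _ _ _ _ _) (p t) (s t) s0 => c q r r0.
exact: third_order_riccati.
Qed.

(** Applied with [b = a^-1] for the lower bound on [sigma] and [b = a] for the upper one. *)
Lemma is_derive_comb (b t : R) : interior X (x + t *: h) ->
  is_derive t 1 (fun r => p r + b * s r) (p t ^+ 2 + s t ^+ 2 + b * ds t).
Proof.
move=> Xt; rewrite -der2E //.
exact: (is_deriveD (is_derive_der1 _ Xt)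
  (is_deriveZ b (is_derive_sqrt_metricG _ Xt))).
Qed.

End Barrier.

(** * The two bounds on [sigma] *)

Section Bounds.
Context {R : realType} {n : nat}.
Variables (X : set 'cV[R]_n) (f : 'cV[R]_n -> R) (a : R).
Hypothesis hX : regular_convex X.
Hypothesis a0 : 0 < a.
Hypothesis hf : proj_sc_barrier X (a - a^-1) f.
Variables (x h : 'cV[R]_n).
Hypothesis Xx : interior X x.

Let w b t := der1 f (x + t *: h) h +
  b * Num.sqrt (metricG f (x + t *: h) h h).

Let w0 b : w b 0 = der1 f x h + b * Num.sqrt (metricG f x h h).
Proof. by rewrite /w scale0r addr0. Qed.

Let cX := regular_convex_convex hX.

Lemma sigma_lower_bound :
  der1 f x h + a^-1 * Num.sqrt (metricG f x h h) <= sigma X x h.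
Proof.
have [->|h0] := eqVneq h 0.
  have d1 : der1 f x 0 = 0 by exact: linear0.
  have d2 : der2 f x 0 0 = 0 by exact: linear0.
  by rewrite /metricG d1 d2 mul0r subr0 sqrtr0 mulr0 addr0 sigma_ge0.
apply: sigma_ge => // t t0 Xt.
rewrite -w0 -[leRHS]mul1r ler_pdivlMr // mulrC leNgt; apply/negP => wt1.
have w0_gt0 : 0 < w a^-1 0 by rewrite -(pmulr_rgt0 _ t0) (lt_trans ltr01).
(* The latest possible blow-up time. As [r < t], all of [[0, r]] stays in the interior, and
   [riccati_lt] gives the absurd [r * w a^-1 0 < 1]. *)
pose r := (w a^-1 0)^-1.
have r0 : 0 < r by rewrite invr_gt0.
have rt : r < t by rewrite /r -[ltLHS]mul1r ltr_pdivrMr.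
have Xi u : 0 <= u <= r -> interior X (x + u *: h).
  by move=> /andP[u0 ur]; apply: (@interior_line _ _ X x h t) => //; lra.
have := @riccati_lt _ (w a^-1) _ r (ltW r0)
  (fun u ur => is_derive_comb _ _ _ hf _ _ h0 a^-1 _ (Xi u ur)).
rewrite /r mulVf ?gt_eqF // ltxx => H; suff // : false by [].
apply: H => u /Xi Xu.
have := sqrt_metricG_riccati _ _ _ hf _ _ h0 _ Xu.
by rewrite ler_norml => /andP[+ _]; exact: riccati_comb_ge.
Qed.

Lemma sigma_upper_bound :
  sigma X x h <= Num.max 0 (der1 f x h + a * Num.sqrt (metricG f x h h)).
Proof.
set W := der1 f x h + _; rewrite leNgt; apply/negP; rewrite gt_max => /andP[s0 ws].
have hbd := boundary_exit _ _ _ Xx cX (regular_convex_closed hX) s0.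
set S := sigma X x h in s0 ws hbd; pose T := S^-1.
have T0 : 0 < T by rewrite invr_gt0.
(* For [h = 0] the exit point would be the interior point [x]. *)
have h0 : h != 0.
  apply/eqP => hE; case: hbd => _; apply.
  by rewrite hE scaler0 addr0.
have Xi u : 0 <= u < T -> interior X (x + u *: h).
  move=> /andP[u0 uT]; apply: interior_below_exit => //.
  by rewrite -ltr_pdivlMr // mul1r.
(* A positive [c >= W] strictly below [S] puts the comparison blow-up time [1 / c] strictly after
   [T], so the bound on [w a] is uniform over [[0, T)]. *)
pose c := (Num.max 0 W + S) / 2.
have [c0 Wc cS] : [/\ 0 < c, W <= c & c < S].
  have m0 : 0 <= Num.max 0 W by rewrite le_max lexx.
  have mW : W <= Num.max 0 W by rewrite le_max lexx orbT.
  have mS : Num.max 0 W < S by rewrite gt_max s0.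
  by rewrite /c; split; lra.
have cT : 0 < c^-1 - T by rewrite subr_gt0 ltf_pV2.
have w_le u : 0 <= u < T -> w a u <= (c^-1 - T)^-1.
  move=> /andP[u0 uT].
  have Xiu v : 0 <= v <= u -> interior X (x + v *: h) by move=> ?; apply: Xi; lra.
  have uc : 0 < c^-1 - u by lra.
  have : w a u <= (c^-1 - u)^-1.
    apply: (@riccati_le _ (w a) _ u c u0 c0 _ _
      (fun v vu => is_derive_comb _ _ _ hf _ _ h0 a _ (Xiu v vu))).
    - by rewrite w0.
    - by rewrite -ltr_pdivlMr // mul1r; lra.
    move=> v /Xiu Xv.
    have := sqrt_metricG_riccati _ _ _ hf _ _ h0 _ Xv.
    by rewrite ler_norml => /andP[_]; exact: riccati_comb_le.
  by move=> /le_trans; apply; rewrite lef_pV2 ?posrE //; lra.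
(* The slope of [f] along the ray is at most [w a], as the square-root term is nonnegative. *)
have f_le u : 0 <= u < T -> f (x + u *: h) <= f x + (c^-1 - T)^-1 * T.
  move=> /andP[u0 uT]; rewrite -lerBlDl.
  have := @le_increment _ (fun r => f (x + r *: h)) _ 0 u (c^-1 - T)^-1 u0.
  rewrite scale0r addr0 subr0 => H.
  apply: (@le_trans _ _ ((c^-1 - T)^-1 * u)).
    apply: (H (fun t => der1 f (x + t *: h) h)) => t tu.
      by apply: (is_derive_barrier _ _ _ hf); apply: Xi; lra.
    have tT : 0 <= t < T by lra.
    apply: le_trans (w_le t tT); rewrite /w lerDl mulr_ge0 ?sqrtr_ge0 //.
    exact: ltW.
  by rewrite ler_pM2l ?invr_gt0 // ltW.
(* Since [harmonic k] is [1 / (k + 1)], these times start at 0, stay below [T] and tend to [T];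
   along them [f] is bounded yet must tend to infinity. *)
pose v k := T * (1 - @harmonic R k).
have vT k : 0 <= v k < T.
  rewrite /v mulr_ge0 ?(ltW T0) //=.
    by rewrite gtr_pMr // gtrBl harmonic_gt0.
  by rewrite subr_ge0 /harmonic invf_le1 // ler1n.
have cv : v @ \oo --> T.
  have h1 : (fun k => 1 - @harmonic R k) @ \oo --> (1 - 0 : R).
    by apply: cvgB; [exact: cvg_cst|exact: cvg_harmonic].
  have : v @ \oo --> T * (1 - 0) by apply: cvgMl_tmp h1.
  by rewrite subr0 mulr1.
have cu : (fun k => x + v k *: h) @ \oo --> x + T *: h.
  exact: (cvg_comp _ _ cv (continuous_line x h T)).
have := psc_barrier hf (fun k => Xi _ (vT k)) hbd cu.
move=> /cvgryPgt /(_ (f x + (c^-1 - T)^-1 * T)) [N _ /(_ N (leqnn N))] /=.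
by rewrite ltNge f_le.
Qed.

End Bounds.

(** * Reversal of the direction, and the final bounds *)

Lemma der1N (R : realType) (n : nat) (f : 'cV[R]_n -> R) (x h : 'cV[R]_n) :
  der1 f x (- h) = - der1 f x h.
Proof. exact: linearN. Qed.

Lemma metricGNN (R : realType) (n : nat) (X : set 'cV[R]_n)
    (f : 'cV[R]_n -> R) (gamma : R) (x h : 'cV[R]_n) :
  proj_sc_barrier X gamma f -> interior X x ->
  metricG f x (- h) (- h) = metricG f x h h.
Proof.
move=> hf Xx; rewrite /metricG !der1N mulrNN; congr (_ - _).
(* The second direction of [der2] enters linearly. The first sits inside the differentiated
   function, so its sign comes out by differentiating a negated function. *)
have der1Nh : (fun y => der1 f y (- h)) = - (fun y => der1 f y h).
  by apply/funext => y; exact: der1N.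
have df : differentiable (fun y => der1 f y h) x by exact: ((psc_C3 hf).2 h).1.
rewrite -[LHS]/(der1 (fun y => der1 f y (- h)) x (- h)) der1N der1Nh.
by rewrite /der1 (diffN df) fctE opprK.
Qed.

Theorem corollary4p1 (R : realType) (n : nat) (X : set 'cV[R]_n)
    (f : 'cV[R]_n -> R) (nu : R)
    (hX : regular_convex X) (hnu : 2 <= nu)
    (hf : proj_sc_barrier X ((nu - 2) / Num.sqrt (nu - 1)) f)
    (x h : 'cV[R]_n) (hx : interior X x) :
  (Num.max 0 (der1 f x h + Num.sqrt (metricG f x h h) / Num.sqrt (nu - 1))
     <= sigma X x h
     <= Num.max 0 (der1 f x h + Num.sqrt (nu - 1) * Num.sqrt (metricG f x h h)))
  /\
  (`|der1 f x h| + Num.sqrt (metricG f x h h) / Num.sqrt (nu - 1)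
     <= pi_gauge X x h
     <= `|der1 f x h| + Num.sqrt (nu - 1) * Num.sqrt (metricG f x h h)).
Proof.
set a := Num.sqrt (nu - 1); set p := der1 f x h.
set s := Num.sqrt (metricG f x h h).
have a0 : 0 < a by rewrite sqrtr_gt0; lra.
have a2 : a ^+ 2 = nu - 1 by rewrite sqr_sqrtr //; lra.
have gammaE : (nu - 2) / a = a - a^-1.
  have -> : nu - 2 = a ^+ 2 - 1 by rewrite a2; ring.
  by field; rewrite gt_eqF.
rewrite -/a gammaE in hf.
have lo := sigma_lower_bound X f a hX a0 hf x h hx.
have up := sigma_upper_bound X f a hX a0 hf x h hx.
have loN := sigma_lower_bound X f a hX a0 hf x (- h) hx.
have upN := sigma_upper_bound X f a hX a0 hf x (- h) hx.
have der1Nh : der1 f x (- h) = - p by exact: der1N.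
rewrite -/p -/s mulrC in lo; rewrite -/p -/s in up.
rewrite (metricGNN _ _ _ _ _ _ _ hf hx) der1Nh -/s mulrC in loN.
rewrite (metricGNN _ _ _ _ _ _ _ hf hx) der1Nh -/s in upN.
have as0 : 0 <= a * s by rewrite mulr_ge0 ?sqrtr_ge0 // ltW.
have p_le : p <= `|p| by exact: ler_norm.
have Np_le : - p <= `|p| by rewrite -normrN ler_norm.
split; first by rewrite up ge_max lo sigma_ge0.
(* For the lower bound, [h] or [- h] is chosen according to the sign of [p], so that the first-order
   term becomes [|p|]. *)
rewrite /pi_gauge; apply/andP; split.
  by rewrite le_max; case: (ger0P p) => _; rewrite ?lo ?loN ?orbT.
rewrite ge_max (le_trans up) ?(le_trans upN) // ge_max;
  by apply/andP; split; have := normr_ge0 p; lra.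
Qed.
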